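(* Assume that the standing assumptions (A1)--(A5) on $(f_0,f_1,\phi_0,\phi_1)$ hold, let $\{x_k\}$ be the sequence of iterates generated by the inexact trust-region algorithm (both described in the context), suppose $\sum_{k=1}^\infty (1+\max_{j=1,\ldots,k}\|B_j\|_{\mathcal{L}(X)})^{-1}=+\infty$, and suppose there exist $0<t_{\min}\le t_{\max}$ such that $t_k\in[t_{\min},t_{\max}]$ for all $k$. Assume that $$f_0(x)=\frac{\tau}{2}\|x\|_X^2+\hat f_0(x),$$ where $\tau>0$, $\hat f_0:X\to\mathbb{R}$ is Fréchet differentiable, and $\nabla\hat f_0$, $f_1$ and $f_1'$ are completely continuous (with $f_1$ Fréchet differentiable on $X$). Moreover, suppose there exist $\bar x\in X$ and an infinite index set $\mathcal{K}\subseteq\mathbb{N}$ such that, as $\mathcal{K}\ni k\to\infty$, $h_k\to0$ and $x_k\rightharpoonup\bar x$ weakly in $X$. Then $\bar x$ is a stationary point of $\min_{x\in X}J(x)$. In addition, if $\hat f_0$ is $\tau_0$-weakly convex with $\tau_0\in(0,\tau)$, i.e., $x\mapsto\frac{\tau_0}{2}\|x\|_X^2+\hat f_0(x)$ is convex, then $x_k\to\bar x$ strongly in $X$ as $\mathcal{K}\ni k\to\infty$.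
   Context: $X,Y$ are real Hilbert spaces, identified with their duals; $\mathcal{L}(X,Y)$ is the space of bounded linear operators with the operator norm, $\mathcal{L}(X)=\mathcal{L}(X,X)$, and $A^*\in\mathcal{L}(Y,X)$ is the Hilbert adjoint of $A\in\mathcal{L}(X,Y)$. For a proper closed convex $\psi$, $\mathrm{dom}\,\psi=\{x:\psi(x)<+\infty\}$, $\partial\psi$ is the convex subdifferential, and $\mathrm{prox}_{\psi}(x)=\arg\min_{x'}\{\frac12\|x'-x\|^2+\psi(x')\}$. A map is completely continuous if it maps weakly convergent sequences to strongly convergent sequences (i.e. $z_n\rightharpoonup z$ implies $G(z_n)\to G(z)$ in norm); here $\nabla\hat f_0:X\to X$, $f_1:X\to Y$, $f_1':X\to\mathcal{L}(X,Y)$. Problem: minimize $J(x)=f_0(x)+\phi_1(f_1(x))+\phi_0(x)$ over $x\in X$. A point $\bar x$ is called stationary if there is $\bar\theta\in\partial\phi_1(f_1(\bar x))$ with $-(\nabla f_0(\bar x)+f_1'(\bar x)^*\bar\theta)\in\partial\phi_0(\bar x)$. Standing assumptions: (A1) $\phi_0:X\to(-\infty,+\infty]$ is proper, closed and convex. (A2) $f_0:X\to\mathbb{R}$, and there is an open set $U\supseteq\mathrm{dom}\,\phi_0$ on which $f_0$ is Fréchet differentiable with $\nabla f_0$ Lipschitz continuous with modulus $M_{f_0}>0$. (A3) $\phi_1:Y\to\mathbb{R}$ is convex and Lipschitz continuous with modulus $M_{\phi_1}>0$. (A4) $f_1:X\to Y$, and there is an open set $V\supseteq\mathrm{dom}\,\phi_0$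 on which $f_1$ is Fréchet differentiable with $f_1'$ Lipschitz continuous with modulus $M_{f_1}>0$. (A5) $J$ is bounded from below by some $\kappa_{\rm lb}\in\mathbb{R}$. Inexact trust-region algorithm. Inputs: $x_1\in\mathrm{dom}\,\phi_0$, $\Delta_1>0$, $0<\eta_1<\eta_2<1$, $0<\gamma_1\le\gamma_2<1\le\gamma_3$. Fixed constants independent of $k$: $\kappa_{\rm rad},\kappa_{\rm fcd},\kappa_{\rm grad},\kappa_{\rm val},\kappa_{\rm jac},\kappa_{\rm obj}>0$, $\zeta>1$, $0<\eta<\min\{\eta_1,1-\eta_2\}$, and positive reals $\zeta_k$ with $\zeta_k\to0$. For $k=1,2,\ldots$: (1) Choose $g_k\in X$, $b_k\in Y$, $A_k\in\mathcal{L}(X,Y)$, $B_k\in\mathcal{L}(X)$, $t_k>0$. Put $q_k(x)=\frac12(B_k(x-x_k),x-x_k)_X+(g_k,x-x_k)_X$, $\ell_k(x)=A_k(x-x_k)+b_k$, $\psi_k(x)=\phi_1(\ell_k(x))+\phi_0(x)$, $m_k=q_k+\psi_k$, and $h_k=\frac1{t_k}\|\mathrm{prox}_{t_k\psi_k}(x_k-t_kg_k)-x_k\|_X$. The choices must satisfy $\|g_k-\nabla f_0(x_k)\|_X\le\kappa_{\rm grad}\min\{h_k,\Delta_k\}$, $\|b_k-f_1(x_k)\|_Y\le\kappa_{\rm val}\min\{h_k,\Delta_k^2\}$, $\|A_k-f_1'(x_k)\|_{\mathcal{L}(X,Y)}\le\kappa_{\rm jac}\min\{h_k,\Delta_k\}$.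 (2) Compute a trial iterate $x_k^+\in X$ with $\|x_k^+-x_k\|_X\le\kappa_{\rm rad}\Delta_k$ and $m_k(x_k)-m_k(x_k^+)\ge\kappa_{\rm fcd}h_k\min\{h_k/(1+\|B_k\|_{\mathcal{L}(X)}),\Delta_k\}$ (in particular $x_k^+\in\mathrm{dom}\,\phi_0$). (3) Let $\mathrm{ared}_k=J(x_k)-J(x_k^+)$, $\mathrm{pred}_k=m_k(x_k)-m_k(x_k^+)$, and let $\mathrm{cred}_k\in\mathbb{R}$ satisfy $|\mathrm{ared}_k-\mathrm{cred}_k|\le\kappa_{\rm obj}[\eta\min\{\mathrm{pred}_k,\zeta_k\}]^{\zeta}$. Set $\rho_k=\mathrm{cred}_k/\mathrm{pred}_k$. (4) If $\rho_k<\eta_1$: $x_{k+1}=x_k$ and $\Delta_{k+1}\in[\gamma_1\Delta_k,\gamma_2\Delta_k]$. Otherwise $x_{k+1}=x_k^+$, with $\Delta_{k+1}\in[\gamma_2\Delta_k,\Delta_k]$ if $\rho_k\in[\eta_1,\eta_2)$ and $\Delta_{k+1}\in[\Delta_k,\gamma_3\Delta_k]$ if $\rho_k\ge\eta_2$. The algorithm is understood to run indefinitely with all ratios $\rho_k$ well defined. Proximity operators are computed exactly. *)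

(* Defs.v *)
From HB Require Import structures.
From mathcomp Require Import all_boot all_order all_algebra.
From mathcomp Require Import sesquilinear.
From mathcomp Require Import all_classical all_reals all_analysis.

Set Implicit Arguments.
Unset Strict Implicit.
Unset Printing Implicit Defensive.

Import Order.TTheory GRing.Theory Num.Theory.
Import numFieldNormedType.Exports.

Local Open Scope classical_set_scope.
Local Open Scope ring_scope.

HB.mixin Record CompleteNormedModule_isHilbert (R : realType) (X : Type)
    of CompleteNormedModule R X := {
  dot : {dot X for idfun};
  dotxx : forall x : X, dot x x = `|x| ^+ 2 }.

#[short(type="hilbertType")]
HB.structure Definition Hilbert (R : realType) :=
  {X of CompleteNormedModule_isHilbert R X & CompleteNormedModule R X}.

Section Operators.
Context {R : realType} {X Y : hilbertType R}.

(* Operator norm; A is a plain function so that it applies to differences of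
   linear maps.  It is meaningful for bounded linear maps only. *)
Definition opnorm (A : X -> Y) : R :=
  sup [set `|A x| | x in [set x : X | `|x| <= 1]].

Definition adjoint (A : X -> Y) (y : Y) : X :=
  xget 0 [set z | forall x, dot (A x) y = dot x z].

End Operators.

Section ConvexAnalysis.
Context {R : realType} {X : hilbertType R}.
Implicit Types psi : X -> \bar R.

(* Riesz representative of the Frechet derivative. *)
Definition grad (f : X -> R) (x : X) : X :=
  xget 0 [set v | forall d, 'd f x d = dot v d].

Definition dom psi : set X := [set x | (psi x < +oo)%E].

Definition proper_efun psi := (forall x, psi x != -oo%E) /\ dom psi !=set0.

Definition closed_efun psi :=
  closed [set z : X * R | (psi z.1 <= z.2%:E)%E].

(* The convention 0 * +oo = 0 is harmless here at the endpoints. *)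
Definition convex_efun psi := forall (x y : X) (s : R), 0 <= s <= 1 ->
  (psi (s *: x + (1 - s) *: y)%R <= s%:E * psi x + (1 - s)%:E * psi y)%E.

Definition subdiff psi (x : X) : set X :=
  [set v | forall y, (psi x + (dot v (y - x)%R)%:E <= psi y)%E].

Definition prox psi (x : X) : X :=
  xget 0 [set p | forall z,
    ((2^-1 * `|p - x| ^+ 2)%:E + psi p <= (2^-1 * `|z - x| ^+ 2)%:E + psi z)%E].

Definition weak_cvg (F : set_system nat) (z : nat -> X) (zbar : X) :=
  forall y, dot (z n) y @[n --> F] --> dot zbar y.

Definition completely_continuous (W : normedModType R) (G : X -> W) :=
  forall z zbar, weak_cvg \oo z zbar -> G (z n) @[n --> \oo] --> G zbar.

Definition completely_continuous_op (Y : hilbertType R) (G : X -> X -> Y) :=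
  forall z zbar, weak_cvg \oo z zbar ->
    opnorm (G (z n) \- G zbar) @[n --> \oo] --> (0 : R).

End ConvexAnalysis.

Section Problem.
Context {R : realType} {X Y : hilbertType R}.
Variables (f0 : X -> R) (f1 : X -> Y) (phi0 : X -> \bar R) (phi1 : Y -> R).

Definition objective (x : X) : \bar R := ((f0 x + phi1 (f1 x))%:E + phi0 x)%E.

Definition stationary (x : X) := exists theta : Y,
  subdiff (EFin \o phi1) (f1 x) theta /\
  subdiff phi0 x (- (grad f0 x + adjoint ('d f1 x) theta)).

Record standing_assumptions : Prop := StandingAssumptions {
  sa_phi0 : [/\ proper_efun phi0, closed_efun phi0 & convex_efun phi0];
  sa_f0 : exists (U : set X) (M : R), [/\ open U, dom phi0 `<=` U, 0 < M,
    {in U, forall x, differentiable f0 x} & M.-lipschitz_U (grad f0)];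
  sa_phi1 : convex_function (setT : set (convex_lmodType Y)) phi1 /\
    exists2 M : R, 0 < M & M.-lipschitz phi1;
  sa_f1 : exists (V : set X) (M : R), [/\ open V, dom phi0 `<=` V, 0 < M,
    {in V, forall x, differentiable f1 x} &
    {in V &, forall x y, opnorm ('d f1 x \- 'd f1 y) <= M * `|x - y|}];
  sa_lb : exists kappa_lb : R, forall x, (kappa_lb%:E <= objective x)%E }.

End Problem.

Record tr_constants (R : realType) := TrConstants {
  eta1 : R; eta2 : R; gamma1 : R; gamma2 : R; gamma3 : R;
  kappa_rad : R; kappa_fcd : R; kappa_grad : R; kappa_val : R;
  kappa_jac : R; kappa_obj : R; eta_obj : R; zeta : R; zetas : nat -> R }.

Record tr_constants_ok (R : realType) (c : tr_constants R) : Prop :=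
  TrConstantsOk {
  ok_eta12 : [/\ 0 < eta1 c, eta1 c < eta2 c & eta2 c < 1];
  ok_gamma :
    [/\ 0 < gamma1 c, gamma1 c <= gamma2 c, gamma2 c < 1 & 1 <= gamma3 c];
  ok_kappa_pos : [/\ 0 < kappa_rad c, 0 < kappa_fcd c & 0 < kappa_grad c];
  ok_kappa_pos' : [/\ 0 < kappa_val c, 0 < kappa_jac c & 0 < kappa_obj c];
  ok_eta : 0 < eta_obj c < Num.min (eta1 c) (1 - eta2 c);
  ok_zeta : 1 < zeta c;
  ok_zetas : (forall k, 0 < zetas c k) /\ zetas c @ \oo --> (0 : R) }.

(* Everything produced by the algorithm; iterations are numbered from 0, so
   that [iter_x r 0] and [radius r 0] are the inputs x_1 and Delta_1. *)
Record tr_run (R : realType) (X Y : hilbertType R) := TrRun {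
  iter_x : nat -> X; trial : nat -> X; radius : nat -> R;
  model_g : nat -> X; model_b : nat -> Y;
  model_A : nat -> {linear X -> Y}; model_B : nat -> {linear X -> X};
  step_t : nat -> R; computed_red : nat -> R }.

Section TrustRegion.
Context {R : realType} {X Y : hilbertType R}.
Variables (f0 : X -> R) (f1 : X -> Y) (phi0 : X -> \bar R) (phi1 : Y -> R).
Variables (c : tr_constants R) (r : tr_run X Y).

Local Notation x_ := (iter_x r).
Local Notation xp_ := (trial r).
Local Notation Delta_ := (radius r).
Local Notation g_ := (model_g r).
Local Notation b_ := (model_b r).
Local Notation A_ := (model_A r).
Local Notation B_ := (model_B r).
Local Notation t_ := (step_t r).
Local Notation J := (objective f0 f1 phi0 phi1).

Definition model_q k (x : X) : R :=
  2^-1 * dot (B_ k (x - x_ k)) (x - x_ k) + dot (g_ k) (x - x_ k).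

Definition model_ell k (x : X) : Y := A_ k (x - x_ k) + b_ k.

Definition model_psi k (x : X) : \bar R :=
  ((phi1 (model_ell k x))%:E + phi0 x)%E.

Definition model_m k (x : X) : \bar R :=
  ((model_q k x)%:E + model_psi k x)%E.

Definition crit k : R :=
  (t_ k)^-1 *
  `|prox (fun x => (t_ k)%:E * model_psi k x)%E (x_ k - t_ k *: g_ k) - x_ k|.

(* [fine] is harmless: along a run, all iterates and trial points lie in [dom phi0]. *)
Definition actual_red k : R := fine (J (x_ k) - J (xp_ k))%E.
Definition predicted_red k : R := fine (model_m k (x_ k) - model_m k (xp_ k))%E.
Definition rho k : R := computed_red r k / predicted_red k.

Record tr_algorithm : Prop := TrAlgorithm {
  alg_constants : tr_constants_ok c;
  alg_init : dom phi0 (x_ 0%N) /\ 0 < Delta_ 0%N;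
  alg_bounded : forall k, continuous (A_ k) /\ continuous (B_ k);
  alg_t : forall k, 0 < t_ k;
  alg_grad : forall k, `|g_ k - grad f0 (x_ k)| <=
    kappa_grad c * Num.min (crit k) (Delta_ k);
  alg_val : forall k, `|b_ k - f1 (x_ k)| <=
    kappa_val c * Num.min (crit k) (Delta_ k ^+ 2);
  alg_jac : forall k, opnorm (A_ k \- 'd f1 (x_ k)) <=
    kappa_jac c * Num.min (crit k) (Delta_ k);
  alg_trial : forall k, `|xp_ k - x_ k| <= kappa_rad c * Delta_ k;
  alg_decrease : forall k,
    ((kappa_fcd c * crit k *
      Num.min (crit k / (1 + opnorm (B_ k))) (Delta_ k))%:E <=
     model_m k (x_ k) - model_m k (xp_ k))%E;
  alg_cred : forall k, `|actual_red k - computed_red r k| <=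
    kappa_obj c * (eta_obj c * Num.min (predicted_red k) (zetas c k)) `^ zeta c;
  alg_rho_defined : forall k, predicted_red k != 0;
  alg_reject : forall k, rho k < eta1 c ->
    x_ k.+1 = x_ k /\ gamma1 c * Delta_ k <= Delta_ k.+1 <= gamma2 c * Delta_ k;
  alg_accept : forall k, eta1 c <= rho k -> x_ k.+1 = xp_ k;
  alg_keep : forall k, eta1 c <= rho k < eta2 c ->
    gamma2 c * Delta_ k <= Delta_ k.+1 <= Delta_ k;
  alg_expand : forall k, eta2 c <= rho k ->
    Delta_ k <= Delta_ k.+1 <= gamma3 c * Delta_ k }.

End TrustRegion.

(* Main.v *)
Require Import Defs.
From HB Require Import structures.
From mathcomp Require Import all_boot all_order all_algebra.
From mathcomp Require Import sesquilinear.
From mathcomp Require Import all_classical all_reals all_analysis.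
From mathcomp Require Import ring lra.

(** The argument follows the proximal points
    [p_k = prox_{t_k psi_k}(x_k - t_k g_k)] rather than the iterates
    themselves.  Since [|p_k - x_k| = t_k h_k <= tmax h_k], along K they have
    the same limits as the [x_k].  Optimality of [p_k] says that
    [(x_k - p_k) / t_k - g_k] is a subgradient of
    [phi1 (A_k (. - x_k) + b_k) + phi0] at [p_k] ([prox_scaled_sum]).

    The accuracy requirements on the model and complete continuity make this
    subgradient inequality a small perturbation of the one for the limit
    function [psi z = phi1 (f1 xbar + f1'(xbar) (z - xbar)) + phi0 z] with the
    slope [- (tau p_k + grad f0hat xbar)]: the gradient of [f0hat] converges in
    norm along [x_k], and so do [f1 (x_k)], [f1' (x_k)] and
    [f1'(xbar) x_k], the latter because the derivative of a completely
    continuous map is completely continuous ([diff_completely_continuous]).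
    The error is at most [delta_k (1 + |z - xbar|)] with [delta_k] tending
    to 0 ([perturbed_subgradient]).

    The linear part [tau p] that remains in the slope is strongly monotone:
    testing the inequality of index i at [p_j] and that of index j at [p_i],
    then adding, everything cancels except
    [tau |p_i - p_j|^2 <= C' (delta_i + delta_j)].  Hence [p_k] is a Cauchy
    family, its strong limit is the weak limit [xbar], and since [psi] is
    closed, passing to the limit yields that [- grad f0 xbar] is a subgradient
    of [psi] at [xbar] ([approx_subgradient_cvg]).  This gives at once the
    strong convergence of the [x_k] and, after splitting the subdifferential
    of [psi] by a sum and chain rule ([subdiff_comp_sum]), stationarity.

    All the existence results on which this rests are obtained from one
    completeness principle, [cvg_sqdist]: a family with
    [|u_i - u_j|^2 <= e_i + e_j] and [e] tending to 0 converges.  It yields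
    proximal points as limits of minimizing sequences, the Riesz
    representation as the optimality condition of a proximal point, and
    subgradients of Lipschitz convex functions as limits of Yosida
    approximations.  The sum rule is the existence of a subgradient at 0 of an
    infimal convolution. *)

Set Implicit Arguments.
Unset Strict Implicit.
Unset Printing Implicit Defensive.

Import Order.TTheory GRing.Theory Num.Theory.
Import numFieldNormedType.Exports.

Local Open Scope classical_set_scope.
Local Open Scope ring_scope.

(** * Inner products, completeness and epigraphs *)

Section InnerProduct.
Context {R : realType} {X : hilbertType R}.
Implicit Types (x y z : X) (a : R).

Lemma dotC x y : dot x y = dot y x.
Proof. by rewrite hermitian_subproof expr0 mul1r. Qed.

Lemma dotDl x y z : dot (x + y) z = dot x z + dot y z.
Proof. by rewrite linearDl. Qed.

Lemma dotDr x y z : dot z (x + y) = dot z x + dot z y.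
Proof. by rewrite linearDr. Qed.

Lemma dotNl x z : dot (- x) z = - dot x z.
Proof. by rewrite linearNl. Qed.

Lemma dotNr x z : dot z (- x) = - dot z x.
Proof. by rewrite linearNr. Qed.

Lemma dotZl a x z : dot (a *: x) z = a * dot x z.
Proof. by rewrite linearZl_LR. Qed.

Lemma dotZr a x z : dot z (a *: x) = a * dot z x.
Proof. by rewrite linearZr_LR. Qed.

Lemma dot0l z : dot 0 z = 0.
Proof. by rewrite linear0l. Qed.

Lemma dot0r z : dot z 0 = 0.
Proof. by rewrite linear0r. Qed.

Definition dotE := (dotDl, dotDr, dotNl, dotNr, dotZl, dotZr).

Lemma sqnormD x y : `|x + y| ^+ 2 = `|x| ^+ 2 + 2 * dot x y + `|y| ^+ 2.
Proof. rewrite -!dotxx !dotE (dotC y x); ring. Qed.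

Lemma sqnormB x y : `|x - y| ^+ 2 = `|x| ^+ 2 - 2 * dot x y + `|y| ^+ 2.
Proof. by rewrite sqnormD dotNr normrN mulrN. Qed.

Lemma sqnormZ a x : `|a *: x| ^+ 2 = a ^+ 2 * `|x| ^+ 2.
Proof. by rewrite normrZ exprMn real_normK// num_real. Qed.

Lemma dot_le_norm x y : `|dot x y| <= `|x| * `|y|.
Proof.
have [->|y0] := eqVneq y 0; first by rewrite dot0r !normr0 mulr0.
have ypos : 0 < `|y| ^+ 2 by rewrite exprn_gt0// normr_gt0.
rewrite -ler_sqr ?nnegrE ?mulr_ge0// exprMn real_normK ?num_real//.
have : 0 <= `|(`|y| ^+ 2) *: x - dot x y *: y| ^+ 2 by rewrite sqr_ge0.
rewrite sqnormB !sqnormZ !dotE.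
set n := `|y| ^+ 2 in ypos *; set m := `|x| ^+ 2; set d := dot x y => H.
rewrite -subr_ge0 -(pmulr_rge0 _ ypos); apply: le_trans H _.
by rewrite le_eqVlt; apply/orP; left; apply/eqP; ring.
Qed.

Lemma dot_ge x y : - (`|x| * `|y|) <= dot x y.
Proof. by have := dot_le_norm x y; rewrite ler_norml => /andP[]. Qed.

Lemma cvg_dot (T : Type) (F : set_system T) {FF : Filter F}
    (u v : T -> X) x y :
  u @ F --> x -> v @ F --> y -> dot (u t) (v t) @[t --> F] --> dot x y.
Proof.
move=> ux vy.
have -> : (fun t => dot (u t) (v t)) =
  (fun t => 2^-1 * (`|u t + v t| ^+ 2 - `|u t| ^+ 2 - `|v t| ^+ 2)).
  by apply/funext => t; rewrite sqnormD; field.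
have -> : dot x y = 2^-1 * (`|x + y| ^+ 2 - `|x| ^+ 2 - `|y| ^+ 2).
  by rewrite sqnormD; field.
apply: cvgMr; apply: cvgB; first apply: cvgB.
- by rewrite expr2; under eq_fun do rewrite expr2; apply: cvgM; apply: cvg_norm; apply: cvgD.
- by rewrite expr2; under eq_fun do rewrite expr2; apply: cvgM; apply: cvg_norm.
- by rewrite expr2; under eq_fun do rewrite expr2; apply: cvgM; apply: cvg_norm.
Qed.

Lemma dot_inj x y : (forall d, dot x d = dot y d) -> x = y.
Proof.
move=> h; apply/eqP; rewrite -subr_eq0 -normr_eq0 -sqrf_eq0 -dotxx.
by rewrite !dotE !(h x) !(h y); apply/eqP; ring.
Qed.

(** Completeness in the form in which it is used for minimizing sequences,
    for Yosida approximations and for approximate subgradients: estimates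
    obtained by comparing two members of a family come as a sum of the errors
    of each of them. *)
Lemma cvg_sqdist (T : Type) (F : set_system T) {FF : ProperFilter F}
    (u : T -> X) (e : T -> R) (A : set T) :
  F A -> e @ F --> 0 ->
  (forall i j, A i -> A j -> `|u i - u j| ^+ 2 <= e i + e j) ->
  exists l : X, u @ F --> l.
Proof.
move=> FA e0 ue.
suff : cauchy (u @ F) by move=> /cauchy_cvgP cu; exists (lim (u @ F)).
apply: cauchy_exP => r r0.
have h0 : 0 < r ^+ 2 / 2 by rewrite divr_gt0// exprn_gt0.
have [i [Ai ei]] : exists i, A i /\ e i < r ^+ 2 / 2.
  have /filter_ex[i [Ai ei]] : F (A `&` [set i | e i < r ^+ 2 / 2]).
    by apply: filterI => //; exact: cvgr_lt e0 _ h0.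
  by exists i.
exists (u i).
suff : F [set j | ball (u i) r (u j)] by [].
have Fe : F [set j | e j < r ^+ 2 / 2] by exact: cvgr_lt e0 _ h0.
apply: filterS (filterI FA Fe) => j [Aj] /= ej.
rewrite -ball_normE /ball_/= -ltr_sqr ?nnegrE ?(ltW r0)//.
by apply: le_lt_trans (ue _ _ Ai Aj) _; lra.
Qed.

End InnerProduct.

Section Epigraph.
Context {R : realType} {X : hilbertType R}.
Implicit Types (psi : X -> \bar R) (x y z : X).

Lemma convex_epi psi x y (a b s : R) : convex_efun psi -> 0 <= s <= 1 ->
  (psi x <= a%:E)%E -> (psi y <= b%:E)%E ->
  (psi (s *: x + (1 - s) *: y)%R <= (s * a + (1 - s) * b)%:E)%E.
Proof.
move=> cpsi s01 xa yb; apply: le_trans (cpsi x y s s01) _.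
case/andP: s01 => s0 s1.
by rewrite (EFinD (s * a)) !EFinM; apply: leeD; apply: lee_wpmul2l; rewrite ?lee_fin ?subr_ge0.
Qed.

Lemma closed_epi psi (T : Type) (F : set_system T) {FF : ProperFilter F}
    (u : T -> X) (r : T -> R) x a : closed_efun psi ->
  u @ F --> x -> r @ F --> a -> (\forall t \near F, (psi (u t) <= (r t)%:E)%E) ->
  (psi x <= a%:E)%E.
Proof.
move=> cl ux ra H.
exact: (@closed_cvg _ (X * R)%type F FF (fun t => (u t, r t)) _ cl H (x, a)
  (cvg_pair ux ra)).
Qed.

Lemma proper_fin psi x : proper_efun psi -> dom psi x -> exists a, psi x = a%:E.
Proof.
move=> [pr _]; rewrite /dom/=; have := pr x.
by case: (psi x) => // a _ _; exists a.
Qed.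

(** Closedness bounds [psi] below near a point [x0] of its domain; along the
    segment from [x0] to a far point, convexity turns this into a lower bound
    of linear growth, which the quadratic term of the proximal problem beats. *)
Lemma closed_convex_minorant psi : proper_efun psi -> closed_efun psi ->
  convex_efun psi -> exists (x0 : X) (a k : R), [/\ psi x0 = a%:E, 0 < k &
    forall z r, (psi z <= r%:E)%E -> a - 1 - k * `|z - x0| <= r].
Proof.
move=> pr cl cv; have [x0 /(proper_fin pr)[a xa]] := pr.2.
exists x0, a.
have : (~` [set z : X * R | (psi z.1 <= z.2%:E)%E]) (x0, a - 1).
  by rewrite /= xa lee_fin; apply/negP; rewrite -ltNge; lra.
move=> nepi.
have op : open (~` [set z : X * R | (psi z.1 <= z.2%:E)%E]) by exact: closed_openC.
have /nbhs_ballP[d /= d0 hd] := open_nbhs_nbhs (conj op nepi).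
exists (2 / d); split=> //; first by rewrite divr_gt0.
have near z r : `|z - x0| < d -> (psi z <= r%:E)%E -> a - 1 < r.
  move=> zx zr; rewrite ltNge; apply/negP => ra.
  apply: (hd (z, a - 1)); last by rewrite /= (le_trans zr)// lee_fin.
  split; last exact: ballxx.
  by rewrite -ball_normE /ball_/= distrC.
move=> z r zr; have [zd|zd] := ltP (`|z - x0|) d.
  have := near _ _ zd zr; have : 0 <= 2 / d * `|z - x0| by rewrite mulr_ge0// divr_ge0// ltW.
  by lra.
have n0 : 0 < `|z - x0| by exact: lt_le_trans zd.
(* This step puts the comparison point at distance d / 2 from x0. *)
pose s := d / (2 * `|z - x0|).
have s0 : 0 < s by rewrite divr_gt0// mulr_gt0.
have sn : s * `|z - x0| = d / 2 by rewrite /s; field; rewrite gt_eqF.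
have s1 : s <= 1 by rewrite ler_pdivrMr ?mulr_gt0// mul1r; lra.
have := @convex_epi psi z x0 r a s cv; rewrite s1 (ltW s0) xa lexx => /(_ isT zr isT).
move=> /near.
have -> : s *: z + (1 - s) *: x0 - x0 = s *: (z - x0).
  by rewrite scalerBl scale1r scalerBr addrA addrAC addrK.
rewrite normrZ gtr0_norm// sn => /(_ ltac:(lra)) H.
have H2 : -1 < s * (r - a) by lra.
have k1 : 2 / d * `|z - x0| = s^-1 by rewrite /s; field; rewrite !gt_eqF.
rewrite k1 -(ler_pM2l s0) !mulrBr mulfV ?gt_eqF//; lra.
Qed.

End Epigraph.

(** * Proximal points and the Riesz representation *)

Section Prox.
Context {R : realType} {X : hilbertType R}.
Implicit Types (psi : X -> \bar R) (x y z : X).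

(** By the parallelogram identity, two points whose values exceed the infimum
    by [e1] and [e2] have midpoint value above the infimum only if their
    squared distance is at most [4 (e1 + e2)]; so minimizing sequences
    converge, and closedness identifies the limit as a minimizer. *)
Lemma prox_exists psi x : proper_efun psi -> closed_efun psi ->
  convex_efun psi -> exists p, forall z,
    ((2^-1 * `|p - x| ^+ 2)%:E + psi p <= (2^-1 * `|z - x| ^+ 2)%:E + psi z)%E.
Proof.
move=> pr cl cv.
have [x0 [a [k [x0a k0 minor]]]] := closed_convex_minorant pr cl cv.
pose S := [set v | exists z r, (psi z <= r%:E)%E /\ v = 2^-1 * `|z - x| ^+ 2 + r].
have Sinf : has_inf S.
  split; first by exists (2^-1 * `|x0 - x| ^+ 2 + a), x0, a; rewrite x0a.
  exists (a - 1 - k * `|x - x0| - k ^+ 2 / 2) => _ [z [r [/minor zr ->]]].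
  have tri : `|z - x0| <= `|z - x| + `|x - x0|.
    by rewrite (le_trans _ (ler_normD _ _))// addrA subrK.
  have := ler_wpM2l (ltW k0) tri; have := sqr_ge0 (`|z - x| - k).
  by rewrite sqrrB mulrDr; move: zr; lra.
have lbS z r : (psi z <= r%:E)%E -> inf S <= 2^-1 * `|z - x| ^+ 2 + r.
  by move=> zr; apply: ge_inf; [exact: Sinf.2|exists z, r].
have /choice[zr Hzr] : forall n, exists zr : X * R, (psi zr.1 <= zr.2%:E)%E /\
    2^-1 * `|zr.1 - x| ^+ 2 + zr.2 < inf S + harmonic n.
  move=> n; have [_ [z [r [h ->]]] lt] := inf_adherent (harmonic_gt0 n) Sinf.
  by exists (z, r).
have [p zp] : exists p : X, (fst \o zr) @ \oo --> p.
  apply: (@cvg_sqdist _ _ _ _ _ _ (fun n => 4 * harmonic n) setT).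
  - exact: filterT.
  - by rewrite -[X in _ --> X](mulr0 4); apply: cvgMr; exact: cvg_harmonic.
  - move=> i j _ _ /=; have [pi li] := Hzr i; have [pj lj] := Hzr j.
    have h01 : 0 <= (2^-1 : R) <= 1 by lra.
    have := lbS _ _ (convex_epi cv h01 pi pj).
    move: li lj; set zi := (zr i).1; set zj := (zr j).1 => li lj.
    have -> : 2^-1 *: zi + (1 - 2^-1) *: zj - x = 2^-1 *: ((zi - x) + (zj - x)).
      have -> : 1 - 2^-1 = 2^-1 :> R by lra.
      rewrite !scalerDr !scalerN addrACA -opprD -scalerDl.
      by rewrite (_ : 2^-1 + 2^-1 = 1 :> R) ?scale1r//; lra.
    rewrite sqnormZ sqnormD.
    have -> : zi - zj = (zi - x) - (zj - x) by rewrite opprB addrA subrK.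
    rewrite (sqnormB (zi - x)); move: li lj; rewrite /harmonic/= expr2.
    by move: (i.+1%:R^-1) (j.+1%:R^-1) => hi hj; lra.
(* Trading the value of psi for the bound given by near-minimality, so that it
   converges and closedness applies. *)
pose r' n := inf S + harmonic n - 2^-1 * `|(zr n).1 - x| ^+ 2.
have r'cvg : r' @ \oo --> inf S + 0 - 2^-1 * `|p - x| ^+ 2.
  apply: cvgB; first by apply: cvgD; [exact: cvg_cst|exact: cvg_harmonic].
  apply: cvgMr; rewrite expr2; under eq_fun do rewrite expr2.
  by apply: cvgM; apply: cvg_norm; apply: cvgB => //; exact: cvg_cst.
have pm : (psi p <= (inf S + 0 - 2^-1 * `|p - x| ^+ 2)%:E)%E.
  apply: closed_epi cl zp r'cvg _; apply: nearW => n.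
  have [h1 h2] := Hzr n; apply: le_trans h1 _; rewrite lee_fin /r'; lra.
exists p => z; case zr' : (psi z) => [r| |]; last 2 first.
- by rewrite addey// leey.
- by have := pr.1 z; rewrite zr'.
apply: le_trans (leeD2l _ pm) _; rewrite -!EFinD lee_fin.
have := lbS z r; rewrite zr' => /(_ (lexx _)); lra.
Qed.

(** Fermat's rule: along the segment from [p] to [y] the quadratic term varies
    to first order by the inner product with [p - x], and convexity bounds the
    variation of [psi] by its chord. *)
Lemma minimizer_subdiff psi x p : proper_efun psi -> convex_efun psi ->
  (forall z,
    ((2^-1 * `|p - x| ^+ 2)%:E + psi p <= (2^-1 * `|z - x| ^+ 2)%:E + psi z)%E) ->
  dom psi p /\ subdiff psi p (x - p).
Proof.
move=> pr cv pmin.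
have pdom : dom psi p.
  have [z0 dz] := pr.2; have [b zb] := proper_fin pr dz.
  have := pmin z0; rewrite zb /dom/=; by case: (psi p) => [c _||]; rewrite ?ltry.
have [a pa] := proper_fin pr pdom.
split=> // y; rewrite pa; case yb : (psi y) => [b| |]; last 2 first.
- by rewrite leey.
- by have := pr.1 y; rewrite yb.
rewrite -EFinD lee_fin -subr_ge0 leNgt; apply/negP => c0.
set n := `|y - p| ^+ 2; set c := a + dot (x - p) (y - p) - b.
have {}c0 : 0 < c by rewrite /c; move: c0; lra.
have n0 : 0 <= n by exact: sqr_ge0.
have key s : 0 < s -> s <= 1 -> c <= s * n / 2.
  move=> s0 s1; have s01 : 0 <= s <= 1 by rewrite s1 ltW.
  have /(_ b a) := convex_epi (x := y) (y := p) cv s01.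
  rewrite yb pa !lexx => /(_ isT isT) H.
  have := le_trans (pmin _) (leeD2l _ H); rewrite pa -!EFinD lee_fin.
  have -> : s *: y + (1 - s) *: p - x = s *: (y - p) - (x - p).
    by rewrite scalerBl scale1r scalerBr opprB !addrA (addrAC (s *: y)).
  rewrite (sqnormB _ (x - p)) sqnormZ dotZl (dotC (y - p)) -(distrC x).
  rewrite /c; set d := dot _ _; rewrite -/n => H2.
  by rewrite -(ler_pM2l s0); lra.
(* As s tends to 0, [key] forces c <= 0; this s <= 1 is already small enough. *)
have := key (c / (c + n)).
have cn : 0 < c + n by lra.
rewrite divr_gt0// ler_pdivrMr// mul1r => /(_ isT ltac:(lra)).
have -> : c / (c + n) * n / 2 = c * n / 2 / (c + n) by field; rewrite gt_eqF.
rewrite ler_pdivlMr// => H.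
have : c * (c + n / 2) <= 0 by lra.
by rewrite leNgt => /negP; apply; apply: mulr_gt0 => //; lra.
Qed.

Lemma prox_subdiff psi x : proper_efun psi -> closed_efun psi ->
  convex_efun psi -> dom psi (prox psi x) /\ subdiff psi (prox psi x) (x - prox psi x).
Proof.
move=> pr cl cv; apply: minimizer_subdiff => //.
have [p pmin] := prox_exists x pr cl cv.
by have := @xgetPex _ 0 [set p | forall z, ((2^-1 * `|p - x| ^+ 2)%:E + psi p <=
    (2^-1 * `|z - x| ^+ 2)%:E + psi z)%E] (ex_intro _ p pmin).
Qed.

End Prox.

Section RealConvex.
Context {R : realType} {X : hilbertType R}.
Implicit Types (f : X -> R) (x y z : X).

Definition convex_real f := forall x y (s : R), 0 <= s <= 1 ->
  f (s *: x + (1 - s) *: y) <= s * f x + (1 - s) * f y.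

Lemma convex_function_real f :
  convex_function (setT : set (convex_lmodType X)) f -> convex_real f.
Proof.
move=> cf x y s s01.
exact: (cf (Itv01 (andP s01).1 (andP s01).2) x y (mem_set I) (mem_set I)).
Qed.

Lemma real_efun f : continuous f -> convex_real f ->
  [/\ proper_efun (EFin \o f), closed_efun (EFin \o f) & convex_efun (EFin \o f)].
Proof.
move=> cf cvf; split.
- by split=> //; exists 0; rewrite /dom/= ltry.
- rewrite /closed_efun (_ : mkset _ = (fun z : X * R => f z.1 - z.2) @^-1` [set t | t <= 0]).
    apply: preimage_closed; last exact: closed_le.
    move=> z _; apply: cvgB; last exact: cvg_snd.
    by apply: (@continuous_comp _ _ _ fst f z); [exact: cvg_fst|exact: cf].
  by apply/seteqP; split => z /=; rewrite lee_fin subr_le0.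
- move=> x y s s01; rewrite /= -!EFinM -EFinD lee_fin; exact: cvf.
Qed.

End RealConvex.

Section Riesz.
Context {R : realType} {X : hilbertType R}.

(** The Riesz vector is the proximal point [p] of [- l] at 0: there [- p] is
    a subgradient of the linear function [- l], hence equal to it. *)
Lemma riesz (l : X -> R) : linear_for *%R l -> continuous l ->
  exists v, forall d, l d = dot v d.
Proof.
move=> ll cl.
have l0 : l 0 = 0 by have := ll 1 0 0; rewrite scale1r addr0; lra.
have lD u v : l (u + v) = l u + l v by have := ll 1 u v; rewrite scale1r mul1r.
have lZ a u : l (a *: u) = a * l u by have := ll a u 0; rewrite l0 !addr0.
have lN u : l (- u) = - l u by rewrite -scaleN1r lZ mulN1r.
have [||pr cl' cv] := @real_efun R X (fun z => - l z).
- by move=> z; apply: cvgN; exact: cl.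
- by move=> x y s _; rewrite lD !lZ; lra.
have [_ sub] := prox_subdiff 0 pr cl' cv.
set p := prox _ _ in sub; exists p => d.
have le e : l e <= dot p e.
  have := sub (p + e); rewrite /= -EFinD lee_fin lD sub0r addrAC subrr add0r dotNl; lra.
by apply/eqP; rewrite eq_le le/=; have := le (- d); rewrite lN dotNr; lra.
Qed.

End Riesz.

(** * Subgradients of Lipschitz convex functions and the sum rule *)

Section LipschitzSubdiff.
Context {R : realType} {X : hilbertType R}.
Implicit Types (x y z : X).

Lemma lipschitz_continuous (P : X -> R) (M : R) : 0 < M ->
  (forall x y, P x - P y <= M * `|x - y|) -> continuous P.
Proof.
move=> M0 lipP x; apply/(@cvgrPdist_lt _ _ _ (nbhs x)) => e e0.
apply/nbhs_ballP; exists (e / M) => /=; first by rewrite divr_gt0.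
move=> y; rewrite -ball_normE /ball_/= ltr_pdivlMr// mulrC => xy.
rewrite ltr_norml; have := lipP x y; have := lipP y x; rewrite (distrC y); lra.
Qed.

(** The Yosida approximations [v_n = (x0 - u_n) / h_n], where [u_n] is the
    proximal point of [h_n P] at [x0], are subgradients of [P] at [u_n].
    Monotonicity of the subdifferential gives
    [|v_i - v_j|^2 <= |v_j|^2 - |v_i|^2] for [i <= j], so that the norms
    increase; they are bounded by the Lipschitz constant, and therefore [v_n]
    converges strongly while [u_n] tends to [x0], and the subgradient
    inequality passes to the limit. *)
Lemma lipschitz_subdiff (P : X -> R) (M : R) x0 : convex_real P -> 0 < M ->
  (forall x y, P x - P y <= M * `|x - y|) ->
  exists v, forall y, P x0 + dot v (y - x0) <= P y.
Proof.
move=> cvP M0 lipP.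
have contP := lipschitz_continuous M0 lipP.
have hpos n : 0 < (harmonic n : R) by exact: harmonic_gt0.
pose h n : R := harmonic n.
have step n : exists v, forall y, P (x0 - h n *: v) + dot v (y - (x0 - h n *: v)) <= P y.
  have h0 : 0 < h n := hpos n.
  have [||pr cl cv] := @real_efun R X (fun z => h n * P z).
  - by move=> z; apply: cvgMr; exact: contP.
  - by move=> x y s s01; have := ler_wpM2l (ltW h0) (cvP x y s s01); lra.
  have [_ sub] := prox_subdiff x0 pr cl cv; set u := prox _ _ in sub.
  exists ((h n)^-1 *: (x0 - u)) => y.
  rewrite scalerA mulfV ?gt_eqF// scale1r subKr.
  have := sub y; rewrite /= -EFinD lee_fin => H.
  rewrite -(ler_pM2l h0) dotZl mulrDr mulrA mulfV ?gt_eqF// mul1r; lra.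
have {step} /choice[v Hv] := step.
pose u n := x0 - h n *: v n; pose b n := `|v n| ^+ 2.
have vM n : b n <= M ^+ 2.
  rewrite /b; suff : `|v n| <= M by move=> H; rewrite ler_sqr ?nnegrE// ltW.
  have unK : u n + v n - u n = v n by move: (u n) => p; rewrite addrAC subrr add0r.
  have [->|v0] := eqVneq (v n) 0; first by rewrite normr0 ltW.
  have vn0 : 0 < `|v n| by rewrite normr_gt0.
  rewrite -(ler_pM2r vn0); have := Hv n (u n + v n); rewrite -/(u n) unK.
  by rewrite dotxx; have := lipP (u n + v n) (u n); rewrite unK; lra.
have key i j : (i <= j)%N -> `|v i - v j| ^+ 2 <= b j - b i.
  rewrite leq_eqVlt => /predU1P[->|ij]; first by rewrite !subrr normr0 expr0n.
  have hij : h j < h i by rewrite ltf_pV2 ?posrE// ltr_nat.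
  have hj : 0 < h j := hpos j.
  have := Hv i (u j); have := Hv j (u i); rewrite -/(u i) -/(u j).
  have -> : u j - u i = h i *: v i - h j *: v j.
    by rewrite /u opprB addrC addrA subrK.
  have -> : u i - u j = h j *: v j - h i *: v i.
    by rewrite /u opprB addrC addrA subrK.
  rewrite !dotE !dotxx (dotC (v j) (v i)) sqnormB -/(b i) -/(b j).
  set d := dot _ _; set sq := b i - 2 * d + b j => H1 H2.
  have sq0 : 0 <= sq by rewrite /sq /b -sqnormB sqr_ge0.
  have H : (h i + h j) * sq <= (h i - h j) * (b j - b i) by rewrite /sq; lra.
  have ba : 0 <= b j - b i.
    rewrite -(pmulr_rge0 _ (_ : 0 < h i - h j)); last by lra.
    by apply: le_trans H; apply: mulr_ge0 => //; lra.
  rewrite -(ler_pM2l (_ : 0 < h i + h j)); last by lra.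
  by apply: le_trans H _; apply: ler_wpM2r => //; lra.
have nd : nondecreasing_seq b.
  by move=> i j ij; rewrite -subr_ge0; apply: le_trans (key _ _ ij); exact: sqr_ge0.
have ubb : has_ubound (range b) by exists (M ^+ 2) => _ [n _ <-].
have bcvg := nondecreasing_cvgn nd ubb; set L := sup _ in bcvg.
have bL n : b n <= L by apply: ub_le_sup => //; exists n.
have [w vw] : exists w : X, v @ \oo --> w.
  apply: (@cvg_sqdist _ _ _ _ _ _ (fun n => L - b n) setT).
  - exact: filterT.
  - by rewrite -[X in _ --> X](subrr L); apply: cvgB => //; exact: cvg_cst.
  - move=> i j _ _; have := bL i; have := bL j.
    have [ij|/ltnW ij] := leqP i j; first by have := key _ _ ij; lra.
    by have := key _ _ ij; rewrite distrC; lra.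
have ux : u @ \oo --> x0.
  rewrite -[X in _ --> X]subr0 -[X in _ - X](scale0r w).
  apply: cvgB; [exact: cvg_cst|apply: cvgZ => //; exact: cvg_harmonic].
exists w => y.
apply: (@cvgr_to_le nat \oo _ R (fun n => P (u n) + dot (v n) (y - u n))).
- apply: cvgD; first exact: (@cvg_comp _ _ _ u P _ _ _ ux (contP x0)).
  by apply: cvg_dot => //; apply: cvgB => //; exact: cvg_cst.
- by apply: nearW => n; exact: Hv.
Qed.

End LipschitzSubdiff.

Section SumRule.
Context {R : realType} {X Y : hilbertType R}.

(** With [p u = phi1 (y0 + u) - phi1 y0] and
    [q d = phi (xb + d) - phi xb - dot v d], the hypothesis on [v] reads
    [0 <= p (D d) + q d].  The perturbation function
    [P u = inf_d (p (u + D d) + q d)] is then finite, convex and Lipschitz, with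
    [P 0 >= 0].  A subgradient [theta] of [P] at 0 works, because [P <= p]
    (take [d = 0]) and [P (- D d) <= q d]. *)
Lemma subdiff_comp_sum (phi : X -> \bar R) (phi1 : Y -> R) (M : R)
    (D : {linear X -> Y}) (y0 : Y) (xb v : X) :
  convex_efun phi -> (exists a, phi xb = a%:E) -> convex_real phi1 -> 0 < M ->
  (forall x y, phi1 x - phi1 y <= M * `|x - y|) ->
  subdiff (fun z => (phi1 (y0 + D (z - xb)))%:E + phi z)%E xb v ->
  exists theta, (forall y, phi1 y0 + dot theta (y - y0) <= phi1 y) /\
    forall z, (phi xb + (dot v (z - xb) - dot theta (D (z - xb)))%:E <= phi z)%E.
Proof.
move=> cv [a xa] cv1 M0 lip sub.
have Hsub d r : (phi (xb + d)%R <= r%:E)%E ->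
    phi1 y0 + a + dot v d <= phi1 (y0 + D d) + r.
  move=> dr; have := sub (xb + d).
  have -> : xb + d - xb = d by rewrite addrAC subrr add0r.
  rewrite subrr linear0 addr0 xa => H.
  by rewrite -lee_fin !EFinD; apply: le_trans H _; apply: leeD2l.
pose S u := [set s | exists d r, (phi (xb + d)%R <= r%:E)%E /\
  s = phi1 (y0 + u + D d) - phi1 y0 + r - a - dot v d].
have lbS u s : S u s -> - (M * `|u|) <= s.
  move=> [d [r [dr ->]]]; have := Hsub _ _ dr; have := lip (y0 + D d) (y0 + u + D d).
  have -> : y0 + D d - (y0 + u + D d) = - u.
    by rewrite (addrAC y0 u) opprD addrA subrr sub0r.
  by rewrite normrN; lra.
have memS u d r : (phi (xb + d)%R <= r%:E)%E ->
  S u (phi1 (y0 + u + D d) - phi1 y0 + r - a - dot v d) by exists d, r.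
have mem0 u : S u (phi1 (y0 + u) - phi1 y0).
  by exists 0, a; rewrite linear0 !addr0 xa dot0r; split => //; lra.
have infS u : has_inf (S u).
  split; first by eexists; exact: mem0.
  by exists (- (M * `|u|)) => s /lbS.
pose P u := inf (S u).
have leP u s : S u s -> P u <= s by move=> us; apply: ge_inf => //; exact: (infS u).2.
have cvP : convex_real P.
  move=> u w s /andP[s0 s1]; apply/ler_addgt0Pr => e e0.
  have [_ [d1 [r1 [dr1 ->]]] lt1] := inf_adherent e0 (infS u).
  have [_ [d2 [r2 [dr2 ->]]] lt2] := inf_adherent e0 (infS w).
  rewrite -/(P u) -/(P w) in lt1 lt2.
  have s01 : 0 <= s <= 1 by rewrite s0.
  have ss : s + (1 - s) = 1 by lra.
  have := convex_epi cv s01 dr1 dr2.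
  have -> : s *: (xb + d1) + (1 - s) *: (xb + d2) = xb + (s *: d1 + (1 - s) *: d2).
    by rewrite !scalerDr addrACA -scalerDl ss scale1r.
  move=> /(memS (s *: u + (1 - s) *: w))/leP/le_trans; apply.
  have := cv1 (y0 + u + D d1) (y0 + w + D d2) s s01.
  have -> : s *: (y0 + u + D d1) + (1 - s) *: (y0 + w + D d2) =
     y0 + (s *: u + (1 - s) *: w) + D (s *: d1 + (1 - s) *: d2).
    have -> : D (s *: d1 + (1 - s) *: d2) = s *: D d1 + (1 - s) *: D d2.
      by rewrite linearD !linearZ.
    rewrite !scalerDr addrACA; congr (_ + _).
    by rewrite addrACA -scalerDl ss scale1r.
  have := ler_wpM2l s0 (ltW lt1).
  have s10 : 0 <= 1 - s by lra.
  have := ler_wpM2l s10 (ltW lt2).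
  rewrite !dotE; lra.
have lipP u w : P u - P w <= M * `|u - w|.
  rewrite lerBlDl -lerBlDr; apply: lb_le_inf; first exact: (infS w).1.
  move=> _ [d [r [dr ->]]]; have := leP _ _ (memS u _ _ dr).
  have := lip (y0 + u + D d) (y0 + w + D d).
  have -> : y0 + u + D d - (y0 + w + D d) = u - w.
    by rewrite opprD addrACA subrr addr0 opprD addrACA subrr add0r.
  lra.
have [th Hth] := lipschitz_subdiff 0 cvP M0 lipP.
have P0 : 0 <= P 0.
  apply: lb_le_inf; first exact: (infS 0).1.
  by move=> s /lbS; rewrite normr0 mulr0 oppr0.
exists th; split => [y|z].
  have yK : y0 + (y - y0) = y by rewrite addrC subrK.
  by have := leP _ _ (mem0 (y - y0)); have := Hth (y - y0); rewrite subr0 yK; lra.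
suff fin r : (phi z <= r%:E)%E -> a + (dot v (z - xb) - dot th (D (z - xb))) <= r.
  rewrite xa -EFinD; case zE : (phi z) fin => [r| |] fin; last 2 first.
  - by rewrite leey.
  - by exfalso; have := fin (a + (dot v (z - xb) - dot th (D (z - xb))) - 1) (leNye _); lra.
  - by rewrite lee_fin; exact: fin.
have zK : xb + (z - xb) = z by rewrite addrC subrK.
move=> zr; have := memS (- D (z - xb)) (z - xb) r.
rewrite zK subrK => /(_ zr)/leP.
by have := Hth (- D (z - xb)); rewrite subr0 dotNr; lra.
Qed.

End SumRule.

(** * Derivatives, operator norms and weak convergence *)

Section Derivatives.
Context {R : realType} {V W : normedModType R}.

Lemma diff_remainder (f : V -> W) x : differentiable f x ->
  forall e, 0 < e -> exists2 d, 0 < d &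
    forall h, `|h| < d -> `|f (x + h) - f x - 'd f x h| <= e * `|h|.
Proof.
move=> /diff_locally /eqaddoP fx e e0.
have /nbhs_ballP[d /= d0 hd] := fx e e0; exists d => // h hh.
have := hd h; rewrite -ball_normE /ball_/= sub0r normrN => /(_ hh).
rewrite [X in `|X| <= _](_ : _ = f (h + x) - (f x + 'd f x h))//.
by rewrite opprD addrA [h + x]addrC.
Qed.

Lemma diff_eq_remainder (f : V -> W) (df : {linear V -> W}) x : continuous df ->
  (forall e, 0 < e -> exists2 d, 0 < d &
    forall h, `|h| < d -> `|f (x + h) - f x - df h| <= e * `|h|) ->
  'd f x = df :> (V -> W).
Proof.
move=> cdf H; apply: diff_unique => //; apply/eqaddoP => e e0.
have [d d0 hd] := H e e0; apply/nbhs_ballP; exists d => // h.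
rewrite -ball_normE /ball_/= sub0r normrN => /hd.
rewrite [X in _ -> is_true (`|X| <= _)](_ : _ = f (h + x) - (f x + df h))//.
by rewrite opprD addrA [h + x]addrC.
Qed.

End Derivatives.

Section RieszRepresentatives.
Context {R : realType} {X Y : hilbertType R}.

Lemma continuous_dot (v : X) : continuous (dot v).
Proof. by move=> x; apply: cvg_dot; [exact: cvg_cst|exact: cvg_id]. Qed.

Lemma gradE (f : X -> R) x d : differentiable f x -> 'd f x d = dot (grad f x) d.
Proof.
move=> dfx; have [||v vE] := @riesz R X ('d f x).
- by move=> a u v; rewrite linearP.
- exact: diff_continuous.
by apply: (@xgetPex _ 0 [set v | forall d, 'd f x d = dot v d]); exists v.
Qed.

Lemma adjointE (A : {linear X -> Y}) x y : continuous A ->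
  dot (A x) y = dot x (adjoint A y).
Proof.
move=> cA; have [||v vE] := @riesz R X (fun x => dot (A x) y).
- by move=> a u v /=; rewrite linearP !dotE.
- move=> z; apply: cvg_dot; [exact: cA|exact: cvg_cst].
apply: (@xgetPex _ 0 [set z | forall x, dot (A x) y = dot x z]).
by exists v => z /=; rewrite vE dotC.
Qed.

Lemma grad_sqnormD (f g : X -> R) (tau : R) x :
  (forall z, f z = tau / 2 * `|z| ^+ 2 + g z) -> differentiable g x ->
  grad f x = tau *: x + grad g x.
Proof.
move=> fE dg.
have lin : linear (fun d : X => dot (tau *: x + grad g x) d : R^o).
  by move=> a u v; rewrite dotDr dotZr.
pose df : {linear X -> R} := HB.pack (fun d : X => dot (tau *: x + grad g x) d : R^o)
  (GRing.isLinear.Build R X R^o *:%R _ lin).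
have dfE d : 'd f x d = dot (tau *: x + grad g x) d.
  suff -> : 'd f x = df :> (X -> R) by [].
  apply: diff_eq_remainder; first exact: continuous_dot.
  move=> e e0; have e2 : 0 < e / 2 by rewrite divr_gt0.
  have [d1 d10 hd] := diff_remainder dg e2.
  have t0 : 0 < `|tau| + 1 by rewrite ltr_wpDl.
  exists (Num.min d1 (e / (`|tau| + 1))); first by rewrite lt_min d10 divr_gt0.
  move=> h; rewrite lt_min => /andP[/hd h1]; rewrite ltr_pdivlMr// => h2.
  have -> : f (x + h) - f x - df h =
      tau / 2 * `|h| ^+ 2 + (g (x + h) - g x - 'd g x h).
    have -> : df h = tau * dot x h + dot (grad g x) h by rewrite -dotZl -dotDl.
    by rewrite !fE sqnormD gradE//; lra.
  apply: le_trans (ler_normD _ _) _.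
  rewrite [leRHS](_ : _ = e / 2 * `|h| + e / 2 * `|h|); last by lra.
  apply: lerD => //; rewrite normrM [`| `|h| ^+ 2|]ger0_norm ?sqr_ge0//.
  rewrite expr2 mulrA; apply: ler_wpM2r => //.
  rewrite normrM [`|2^-1|]ger0_norm//; have := normr_ge0 h; nra.
apply: dot_inj => d'; rewrite -dfE.
apply/esym; apply: (@xgetPex _ 0 [set v | forall d, 'd f x d = dot v d]) => //.
by exists (tau *: x + grad g x).
Qed.

Lemma opnorm_bound (A : {linear X -> Y}) x : continuous A ->
  `|A x| <= opnorm A * `|x|.
Proof.
move=> /linear_bounded_continuous/bounded_funP/(_ 1)[M AM].
have [->|x0] := eqVneq x 0; first by rewrite linear0 !normr0 mulr0.
have n0 : 0 < `|x| by rewrite normr_gt0.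
rewrite -ler_pdivrMr//.
have -> : `|A x| / `|x| = `|A (`|x|^-1 *: x)|.
  by rewrite linearZ normrZ ger0_norm ?invr_ge0// mulrC.
apply: ub_le_sup; first by exists M => _ [z /= z1 <-]; exact: AM.
by exists (`|x|^-1 *: x) => //=; rewrite normrZ ger0_norm ?invr_ge0// mulVf ?gt_eqF.
Qed.

Lemma opnorm_ge0 (A : {linear X -> Y}) : continuous A -> 0 <= opnorm A.
Proof.
move=> /linear_bounded_continuous/bounded_funP/(_ 1)[M AM].
apply: ub_le_sup; first by exists M => _ [z /= z1 <-]; exact: AM.
by exists 0; rewrite /= ?linear0 normr0.
Qed.

Lemma opnormB_bound (A B : {linear X -> Y}) x : continuous A -> continuous B ->
  `|A x - B x| <= opnorm (A \- B) * `|x|.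
Proof.
move=> cA cB; apply: (opnorm_bound (A := (A \- B : {linear X -> Y}))).
by move=> z; apply: cvgB; [exact: cA|exact: cB].
Qed.

End RieszRepresentatives.

Section AffineComposition.
Context {R : realType} {X Y : hilbertType R}.
Variables (phi1 : Y -> R) (A : {linear X -> Y}) (x0 : X) (c : Y).

Lemma convex_real_affine : convex_real phi1 ->
  convex_real (fun z => phi1 (c + A (z - x0))).
Proof.
move=> cv x y s s01; apply: le_trans (cv _ _ _ s01).
have ss : s + (1 - s) = 1 by lra.
have -> : s *: x + (1 - s) *: y - x0 = s *: (x - x0) + (1 - s) *: (y - x0).
  by rewrite !scalerBr addrACA -opprD -scalerDl ss scale1r.
have -> : A (s *: (x - x0) + (1 - s) *: (y - x0)) =
  s *: A (x - x0) + (1 - s) *: A (y - x0) by rewrite linearD !linearZ.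
rewrite [leRHS](_ : _ = phi1 (c + (s *: A (x - x0) + (1 - s) *: A (y - x0))))//.
congr phi1; rewrite !scalerDr addrACA; congr (_ + _).
by rewrite -scalerDl ss scale1r.
Qed.

Lemma continuous_affine : continuous A -> continuous phi1 ->
  continuous (fun z => phi1 (c + A (z - x0))).
Proof.
move=> cA c1 x; apply: (@continuous_comp _ _ _ (fun z => c + A (z - x0)) phi1 x _ (c1 _)).
apply: cvgD; first exact: cvg_cst.
apply: (@continuous_comp _ _ _ (fun z => z - x0) A x _ (cA _)).
by apply: cvgB; [exact: cvg_id|exact: cvg_cst].
Qed.

End AffineComposition.

Section WeakConvergence.
Context {R : realType} {X : hilbertType R}.

(** The uniform boundedness principle, applied to the functionals
    [dot (z n)]. *)
Lemma weak_cvg_bounded (z : nat -> X) zbar : weak_cvg \oo z zbar ->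
  exists2 C, 0 < C & forall n, `|z n| <= C.
Proof.
move=> zw.
pose Fam : set (X -> R^o) := [set f | exists n, f = dot (z n)].
have [|x|M HM] := @Banach_Steinhauss R X R^o Fam _ _ 1.
- move=> _ [n ->]; split; last by move=> a u v; rewrite dotDr dotZr.
  move=> r; exists (`|z n| * r) => x xr.
  by apply: le_trans (dot_le_norm _ _) _; apply: ler_wpM2l.
- have /cvg_seq_bounded/pinfty_ex_gt0[M M0 zM] : cvgn (fun n => dot (z n) x : R^o).
    by apply/cvg_ex; exists (dot zbar x); exact: zw.
  by exists M => _ [n ->]; exact: zM.
exists (`|M| + 1) => [|n]; first by rewrite ltr_wpDl.
apply: (@le_trans _ _ `|M|); last by rewrite lerDl.
have [->|zn] := eqVneq (z n) 0; first by rewrite normr0.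
have n0 : 0 < `|z n| by rewrite normr_gt0.
have := HM (dot (z n)) (ex_intro _ n erefl) (`|z n|^-1 *: z n).
rewrite normrZ ger0_norm ?invr_ge0// mulVf ?gt_eqF// lexx => /(_ isT).
rewrite dotZr dotxx expr2 mulrA mulVf ?gt_eqF// mul1r ger0_norm// => H.
exact: le_trans H (ler_norm _).
Qed.

Lemma within_cvg (W : topologicalType) (K : set nat) (u v : nat -> W) (l : W) :
  (forall n, K n -> u n = v n) -> u @ \oo --> l -> v @ within K \oo --> l.
Proof.
move=> uv ul A /ul; rewrite /= !nbhs_simpl /within/=.
by apply: filterS => n An Kn; rewrite /= -uv.
Qed.

(** Complete continuity speaks of sequences: filling the indices outside K with
    the limit turns weak convergence along K into that of a sequence. *)
Lemma weak_cvg_extend (K : set nat) (u : nat -> X) ubar :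
  weak_cvg (within K \oo) u ubar ->
  weak_cvg \oo (fun n => if n \in K then u n else ubar) ubar.
Proof.
move=> uw y; apply/(@cvgrPdist_lt _ _ _ \oo) => e e0.
have := uw y; move/(@cvgrPdist_lt _ _ _ (within K \oo)) => /(_ e e0).
rewrite near_withinE; apply: filterS => n H.
by case: ifPn => [/set_mem/H//|_]; rewrite subrr normr0.
Qed.

Lemma completely_continuous_within (W : normedModType R) (G : X -> W)
    (K : set nat) (u : nat -> X) ubar :
  completely_continuous G -> weak_cvg (within K \oo) u ubar ->
  G (u n) @[n --> within K \oo] --> G ubar.
Proof.
move=> cG /weak_cvg_extend/cG; apply: within_cvg => n Kn.
by rewrite mem_set.
Qed.

(** If [z n] tends weakly to [zbar], then [x + s (z n - zbar)] tends weakly to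
    [x], so [f] along it tends to [f x].  As [z n - zbar] is bounded, for small
    fixed [s] the difference quotient is uniformly close to
    ['d f x (z n - zbar)], which must therefore become small. *)
Lemma diff_completely_continuous (W : normedModType R) (f : X -> W) x :
  differentiable f x -> completely_continuous f -> completely_continuous ('d f x).
Proof.
move=> dfx ccf z zbar zw.
have dw (s : R) : weak_cvg \oo (fun n => x + s *: (z n - zbar)) x.
  move=> y.
  have -> : (fun n => dot (x + s *: (z n - zbar)) y) =
     (fun n => dot x y + s * (dot (z n) y - dot zbar y)).
    by apply/funext => n; rewrite !dotE.
  rewrite -[X in _ --> X]addr0 -[X in _ + X](mulr0 s) -[X in s * X](subrr (dot zbar y)).
  apply: cvgD; first exact: cvg_cst.
  by apply: cvgMr; apply: cvgB; [exact: zw|exact: cvg_cst].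
have [C C0 HC] : exists2 C, 0 < C & forall n, `|z n - zbar| <= C.
  have [C C0 HC] := weak_cvg_bounded zw; exists (C + `|zbar|).
    by rewrite ltr_pwDl.
  by move=> n; apply: le_trans (ler_normB _ _) _; rewrite lerD2r.
apply/(@cvgrPdist_le _ _ _ \oo) => e e0.
(* The quotient is within e1 C of the linear term, and f along the sequence
   within e1 s of f x: together e1 (C + 1) = e. *)
pose e1 := e / (C + 1).
have C1 : 0 < C + 1 by rewrite ltr_wpDl// ltW.
have e10 : 0 < e1 by rewrite divr_gt0.
have [d d0 hd] := diff_remainder dfx e10.
pose s := d / (C + 1).
have s0 : 0 < s by rewrite divr_gt0.
have es : 0 < e1 * s by rewrite mulr_gt0.
have := ccf _ _ (dw s); move/(@cvgrPdist_le _ _ _ \oo) => /(_ _ es).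
apply: filterS => n Hn.
have sz : `|s *: (z n - zbar)| <= s * C by rewrite normrZ gtr0_norm// ler_wpM2l// ltW.
have sd : `|s *: (z n - zbar)| < d.
  apply: le_lt_trans sz _; rewrite /s mulrAC ltr_pdivrMr// ltr_pM2l//; lra.
have DE : 'd f x (s *: (z n - zbar)) = s *: ('d f x (z n) - 'd f x zbar).
  by rewrite linearZ/=; congr (_ *: _); rewrite linearB.
have := hd _ sd; rewrite DE.
set dz := 'd f x (z n) - 'd f x zbar => H.
have : `|s *: dz| <= e1 * s + e1 * (s * C).
  rewrite distrC in Hn.
  have -> : s *: dz = (f (x + s *: (z n - zbar)) - f x) -
     (f (x + s *: (z n - zbar)) - f x - s *: dz) by rewrite subKr.
  apply: le_trans (ler_normB _ _) _; apply: lerD => //.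
  by apply: le_trans H _; apply: ler_wpM2l => //; exact: ltW.
rewrite normrZ gtr0_norm// [leRHS](_ : _ = s * e); last by rewrite /e1; field; rewrite gt_eqF.
by rewrite ler_pM2l// distrC.
Qed.

End WeakConvergence.

(** * Approximate subgradients *)

Section ScaledSum.
Context {R : realType} {X : hilbertType R}.
Variables (phi : X -> \bar R) (f : X -> R) (t : R).
Hypotheses (pr : proper_efun phi) (cl : closed_efun phi) (cv : convex_efun phi).
Hypotheses (cf : continuous f) (cvf : convex_real f) (t0 : 0 < t).

Let psi z := (t%:E * ((f z)%:E + phi z))%E.

Let psi_le z r : (psi z <= r%:E)%E = (phi z <= (t^-1 * r - f z)%:E)%E.
Proof.
rewrite /psi; case: (phi z) => [b| |] /=.
- by rewrite -EFinD -EFinM !lee_fin lerBrDl ler_pdivlMl.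
- by rewrite addey// gt0_muley ?lte_fin.
- by rewrite addeNy gt0_muleNy ?lte_fin// !leNye.
Qed.

Let psi_proper : proper_efun psi.
Proof.
split=> [z|].
  rewrite /psi; have := pr.1 z; case: (phi z) => // _.
  by rewrite addey// gt0_muley ?lte_fin.
have [z0 /(proper_fin pr)[b zb]] := pr.2; exists z0.
by rewrite /dom/= /psi zb -EFinD -EFinM ltry.
Qed.

Let psi_closed : closed_efun psi.
Proof.
rewrite /closed_efun (_ : mkset _ = (fun z : X * R => (z.1, t^-1 * z.2 - f z.1)) @^-1`
   [set z : X * R | (phi z.1 <= z.2%:E)%E]).
  apply: preimage_closed cl => z _.
  have c2 : (fun z : X * R => t^-1 * z.2 - f z.1) @ z --> t^-1 * z.2 - f z.1.
    apply: cvgB; first by apply: cvgMr; exact: cvg_snd.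
    by apply: (@continuous_comp _ _ _ fst f z); [exact: cvg_fst|exact: cf].
  exact: (cvg_pair (@cvg_fst _ _ (nbhs z.1) (nbhs z.2) _) c2).
by apply/seteqP; split => z /=; rewrite psi_le.
Qed.

Let psi_convex : convex_efun psi.
Proof.
move=> x y s /andP[s0 s1].
have [->|sn0] := eqVneq s 0.
  by rewrite subr0 scale0r scale1r add0r mul0e mul1e add0e.
have [->|sn1] := eqVneq s 1.
  by rewrite subrr scale0r scale1r addr0 mul0e mul1e adde0.
have sp : 0 < s by rewrite lt_def sn0.
have sp1 : 0 < 1 - s by rewrite subr_gt0 lt_def eq_sym sn1.
case px : (phi x) (pr.1 x) => [a| |] // _; last first.
  rewrite {2}/psi px addey// !gt0_muley ?lte_fin// addye ?leey//.
  rewrite /psi; case py : (phi y) (pr.1 y) => [b| |] // _.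
  by rewrite addey// !gt0_muley ?lte_fin.
case py : (phi y) (pr.1 y) => [b| |] // _; last first.
  by rewrite {3}/psi py addey// !gt0_muley ?lte_fin// {2}/psi px -EFinD -!EFinM addey// leey.
rewrite {2 3}/psi px py.
have -> : (s%:E * (t%:E * ((f x)%:E + a%:E)) + (1 - s)%:E * (t%:E * ((f y)%:E + b%:E)))%E =
  (s * (t * (f x + a)) + (1 - s) * (t * (f y + b)))%:E by [].
rewrite psi_le.
have s01 : 0 <= s <= 1 by rewrite s0.
have /(_ a b) := convex_epi (x := x) (y := y) cv s01.
rewrite px py !lexx => /(_ isT isT)/le_trans; apply; rewrite lee_fin.
have := cvf x y s01; rewrite lerBrDl.
rewrite [t^-1 * _](_ : _ = s * (f x + a) + (1 - s) * (f y + b)); first lra.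
by field; rewrite gt_eqF.
Qed.

Lemma scaled_sum_efun : [/\ proper_efun psi, closed_efun psi & convex_efun psi].
Proof. by []. Qed.

(** The optimality condition of the proximal point of [t (f + phi)], divided by
    [t] and stated for real upper bounds [r] of [phi z], which frees its uses
    from extended-real arithmetic. *)
Lemma prox_scaled_sum x (p := prox (fun z => t%:E * ((f z)%:E + phi z))%E x) :
  exists2 a, phi p = a%:E & forall z r, (phi z <= r%:E)%E ->
    f p + a + t^-1 * dot (x - p) (z - p) <= f z + r.
Proof.
have [dp sub] := prox_subdiff x psi_proper psi_closed psi_convex.
rewrite -/p in dp sub.
have [c pc] := proper_fin psi_proper dp.
have : dom phi p.
  have : (psi p <= c%:E)%E by rewrite pc.
  by rewrite psi_le /dom/= => /le_lt_trans; apply; rewrite ltry.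
move=> /(proper_fin pr)[a pa]; exists a => // z r zr.
have H : (psi z <= (t * (f z + r))%:E)%E by rewrite psi_le mulKf ?gt_eqF// addrAC subrr add0r.
have := le_trans (sub z) H; rewrite /psi pa.
rewrite -[X in (X <= _)%E]/((t * (f p + a) + dot (x - p) (z - p))%:E) lee_fin.
by move=> H2; rewrite -(ler_pM2l t0) mulrDr mulrA mulfV ?gt_eqF// mul1r.
Qed.

End ScaledSum.

Section ApproximateSubgradients.
Context {R : realType} {X : hilbertType R}.

(** The slopes [- (tau p_k + G)] are approximate subgradients of [psi] at [p_k].
    Comparing indices i and j, the values of [psi] and the terms in [G] cancel,
    and the strong monotonicity of [tau] times the identity leaves a Cauchy
    estimate. *)
Lemma approx_subgradient_cvg (F : set_system nat) {FF : ProperFilter F}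
    (psi : X -> \bar R) (p : nat -> X) (delta : nat -> R) (A : set nat)
    (tau C : R) (G xb : X) :
  proper_efun psi -> closed_efun psi -> 0 < tau -> F A ->
  (forall k, A k -> 0 <= delta k) -> delta @ F --> 0 ->
  (forall k, A k -> `|p k - xb| <= C) -> weak_cvg F p xb ->
  (forall k, A k -> exists2 a, psi (p k) = a%:E &
    forall z r, (psi z <= r%:E)%E ->
      a - tau * dot (p k) (z - p k) - dot G (z - p k)
        - delta k * (1 + `|z - xb|) <= r) ->
  [/\ p @ F --> xb, dom psi xb & subdiff psi xb (- (tau *: xb + G))].
Proof.
move=> pr cl tau0 FA delta0 deltacvg pC pw VI.
have [l pl] : exists l : X, p @ F --> l.
  apply: (cvg_sqdist (e := fun k => (1 + C) / tau * delta k) FA).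
    by rewrite -[X in _ --> X](mulr0 ((1 + C) / tau)); apply: cvgMr.
  move=> i j Ai Aj; rewrite -(ler_pM2l tau0).
  have [a ia /(_ (p j))] := VI i Ai; have [b jb /(_ (p i))] := VI j Aj.
  rewrite ia jb => /(_ a (lexx _)) H1 /(_ b (lexx _)) H2.
  have eE k : tau * ((1 + C) / tau * delta k) = delta k * (1 + C).
    by field; rewrite gt_eqF.
  rewrite mulrDr !eE.
  have di := ler_wpM2l (delta0 i Ai) (lerD (lexx 1) (pC j Aj)).
  have dj := ler_wpM2l (delta0 j Aj) (lerD (lexx 1) (pC i Ai)).
  apply: (@le_trans _ _ (delta i * (1 + `|p j - xb|) + delta j * (1 + `|p i - xb|))).
    move: H1 H2; rewrite sqnormB -!dotxx !dotE (dotC (p j) (p i)); lra.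
  exact: lerD.
have lxb : l = xb.
  apply: dot_inj => y; apply: (@cvg_unique _ (@norm_hausdorff _ R^o) _ _ _ _ _ (pw y)).
  by apply: cvg_dot => //; exact: cvg_cst.
rewrite lxb in pl.
have lim z r : (psi z <= r%:E)%E ->
    (psi xb <= (r + tau * dot xb (z - xb) + dot G (z - xb))%:E)%E.
  move=> zr.
  pose q k := r + tau * dot (p k) (z - p k) + dot G (z - p k) + delta k * (1 + `|z - xb|).
  have zp : (z - p k) @[k --> F] --> z - xb by apply: cvgB => //; exact: cvg_cst.
  apply: (closed_epi (F := F) (r := q) cl pl).
  - rewrite -[X in _ --> X]addr0 -[X in _ + X](mul0r (1 + `|z - xb|)).
    apply: cvgD; last by apply: cvgMl.
    apply: cvgD; last by apply: cvg_dot => //; exact: cvg_cst.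
    by apply: cvgD; [exact: cvg_cst|apply: cvgMr; exact: cvg_dot].
  - apply: filterS FA => k Ak; have [a -> /(_ z r zr)] := VI k Ak.
    by rewrite lee_fin /q; lra.
have [z0 /(proper_fin pr)[b zb]] := pr.2.
have xdom : dom psi xb.
  by rewrite /dom/=; apply: le_lt_trans (lim z0 b _) _; rewrite ?zb ?ltry.
have [a xa] := proper_fin pr xdom.
split=> // z; rewrite xa; case zE : (psi z) => [c| |].
- have := lim z c; rewrite zE xa => /(_ (lexx _)).
  by rewrite -EFinD !lee_fin !dotE; lra.
- by rewrite leey.
- by have := pr.1 z; rewrite zE.
Qed.

End ApproximateSubgradients.

Section Perturbation.
Context {R : realType} {X Y : hilbertType R}.

(** The passage from the model [A, b, g] at [x] to the data [D, y0, G] at the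
    limit point [xb]: each of the errors [eA], [eb], [eR] enters linearly, with
    a factor growing like [1 + |z - xb|].  The inequality is first used at an
    arbitrary [z], and the replacement of [A] by [D] happens at [z] and at [p];
    this is where [2 + C = (1 + C) + 1] comes from. *)
Lemma perturbed_subgradient (phi : X -> \bar R) (phi1 : Y -> R) (A D : X -> Y)
    (b y0 : Y) (x p g G xb : X) (M C eA eb eR tau t a : R) :
  {morph A : u v / u + v} -> {morph D : u v / u + v} ->
  0 < t -> 0 < M ->
  (forall u v, phi1 u - phi1 v <= M * `|u - v|) ->
  0 <= C -> `|x - xb| <= C -> `|p - xb| <= C ->
  0 <= eA -> (forall d, `|A d - D d| <= eA * `|d|) ->
  `|b - y0 - D (x - xb)| <= eb ->
  `|t^-1 *: (x - t *: g - p) + tau *: p + G| <= eR ->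
  (forall z r, (phi z <= r%:E)%E ->
    phi1 (A (p - x) + b) + a + t^-1 * dot (x - t *: g - p) (z - p) <=
    phi1 (A (z - x) + b) + r) ->
  forall z r, (phi z <= r%:E)%E ->
    phi1 (y0 + D (p - xb)) + a - tau * dot p (z - p) - dot G (z - p) -
    ((M * (eA + eb) * (2 + C) + eR) * (1 + C)) * (1 + `|z - xb|) <=
    phi1 (y0 + D (z - xb)) + r.
Proof.
move=> AD DD t0 M0 lip C0 xC pC eA0 HA Hb HR VI z r zr.
have eb0 : 0 <= eb := le_trans (normr_ge0 _) Hb.
have eR0 : 0 <= eR := le_trans (normr_ge0 _) HR.
have HL v : `|A (v - x) + b - (y0 + D (v - xb))| <= (eA + eb) * ((1 + C) * (1 + `|v - xb|)).
  have -> : A (v - x) + b - (y0 + D (v - xb)) =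
      (A (v - x) - D (v - x)) + (b - y0 - D (x - xb)).
    have -> : v - xb = (v - x) + (x - xb) by rewrite addrA subrK.
    rewrite (DD (v - x)) !opprD !addrA; congr (_ - _).
    by rewrite (addrAC _ (- y0)) (addrAC (A (v - x)) b).
  apply: le_trans (ler_normD _ _) _; rewrite mulrDl; apply: lerD.
    apply: le_trans (HA _) _; apply: ler_wpM2l => //.
    have : `|v - x| <= `|v - xb| + `|x - xb|.
      by have := ler_normB (v - xb) (x - xb); rewrite opprB addrA subrK.
    have := normr_ge0 (v - xb); nra.
  apply: le_trans Hb _; rewrite ler_peMr//; have := normr_ge0 (v - xb); nra.
have Hzp : `|z - p| <= (1 + C) * (1 + `|z - xb|).
  have : `|z - p| <= `|z - xb| + `|p - xb|.
    by have := ler_normB (z - xb) (p - xb); rewrite opprB addrA subrK.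
  have := normr_ge0 (z - xb); nra.
have Hdot : - (eR * ((1 + C) * (1 + `|z - xb|))) <=
   t^-1 * dot (x - t *: g - p) (z - p) + tau * dot p (z - p) + dot G (z - p).
  rewrite -!dotZl -!dotDl; apply: le_trans (dot_ge _ _); rewrite lerN2.
  exact: ler_pM.
have lz := lip (A (z - x) + b) (y0 + D (z - xb)).
have lp := lip (y0 + D (p - xb)) (A (p - x) + b).
have := VI z r zr.
have := ler_wpM2l (ltW M0) (HL z).
have := ler_wpM2l (ltW M0) (HL p).
rewrite (distrC (A (p - x) + b)) => Hp Hz HVI.
have n0 : 0 <= `|z - xb| by [].
have pC' : M * ((eA + eb) * ((1 + C) * (1 + `|p - xb|))) <=
    M * ((eA + eb) * ((1 + C) * (1 + C))) * (1 + `|z - xb|).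
  apply: (@le_trans _ _ (M * ((eA + eb) * ((1 + C) * (1 + C))))).
    apply: ler_wpM2l; first exact: ltW.
    apply: ler_wpM2l; first exact: addr_ge0.
    by apply: ler_wpM2l; [exact: addr_ge0|rewrite lerD2l].
  rewrite ler_peMr ?lerDl//; do ?[apply: mulr_ge0|apply: addr_ge0] => //; exact: ltW.
move: pC' Hp Hz HVI lz lp Hdot; lra.
Qed.

End Perturbation.

(** * Stationarity along the selected iterations *)

Lemma within_infinite_proper (K : set nat) : infinite_set K ->
  ProperFilter (within K \oo).
Proof.
move=> infK; apply: Build_ProperFilter => -[N _ NK]; apply: infK.
apply: (@sub_finite_set _ _ `I_N); last exact: finite_II.
by move=> n Kn /=; rewrite ltnNge; apply/negP => /NK; exact.
Qed.

Section NullSequences.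
Context {R : realType} (F : set_system nat) {FF : Filter F}.
Implicit Types u v : nat -> R.

Lemma cvg0_squeeze u v (a : R) :
  (forall k, 0 <= u k <= a * v k) -> v @ F --> 0 -> u @ F --> 0.
Proof.
move=> uv v0; apply: (squeeze_cvgr (f := fun=> 0) (h := fun k => a * v k)).
- exact: nearW.
- exact: cvg_cst.
- by rewrite -[X in _ --> X](mulr0 a); exact: cvgMr.
Qed.

Lemma cvg0M u (a : R) : u @ F --> 0 -> a * u k @[k --> F] --> 0.
Proof. by move=> u0; rewrite -[X in _ --> X](mulr0 a); exact: cvgMr. Qed.

Lemma cvg0D u v : u @ F --> 0 -> v @ F --> 0 -> u k + v k @[k --> F] --> 0.
Proof. by move=> u0 v0; rewrite -[X in _ --> X](addr0 0); exact: cvgD. Qed.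

Lemma cvg0_dist (W : normedModType R) (w : nat -> W) (l : W) :
  w @ F --> l -> `|w k - l| @[k --> F] --> 0.
Proof.
move=> wl; rewrite -(normr0 W); apply: cvg_norm; rewrite -(subrr l).
by apply: cvgB => //; exact: cvg_cst.
Qed.

End NullSequences.

Theorem theorem16 (R : realType) (X Y : hilbertType R)
  (f0 : X -> R) (f1 : X -> Y) (phi0 : X -> \bar R) (phi1 : Y -> R)
  (hsa : standing_assumptions f0 f1 phi0 phi1)
  (c : tr_constants R) (r : tr_run X Y)
  (halg : tr_algorithm f0 f1 phi0 phi1 c r)
  (hB : (\sum_(0 <= k <oo)
     ((1 + \big[Num.max/0]_(j < k.+1) opnorm (model_B r j))^-1)%:E = +oo)%E)
  (tmin tmax : R) (htmin : 0 < tmin) (htminmax : tmin <= tmax)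
  (ht : forall k, tmin <= step_t r k <= tmax)
  (tau : R) (f0hat : X -> R) (htau : 0 < tau)
  (hf0 : forall x, f0 x = tau / 2 * `|x| ^+ 2 + f0hat x)
  (hf0hat : forall x, differentiable f0hat x)
  (hf1 : forall x, differentiable f1 x)
  (hccgrad : completely_continuous (grad f0hat))
  (hccf1 : completely_continuous f1)
  (hccdf1 : completely_continuous_op (fun x => 'd f1 x))
  (xbar : X) (K : set nat) (hK : infinite_set K)
  (hcrit : crit phi0 phi1 r k @[k --> within K \oo] --> (0 : R))
  (hweak : weak_cvg (within K \oo) (iter_x r) xbar) :
  stationary f0 f1 phi0 phi1 xbar /\
  (forall tau0 : R, 0 < tau0 < tau ->
     convex_function (setT : set (convex_lmodType X))
       (fun x : X => tau0 / 2 * `|x| ^+ 2 + f0hat x) ->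
     iter_x r k @[k --> within K \oo] --> xbar).
Proof.
have [[pr cl cv] _ [/convex_function_real cv1 [M M0 lipM]] _ _] := hsa.
have lip u v : phi1 u - phi1 v <= M * `|u - v|.
  exact: le_trans (ler_norm _) (lipM (u, v) (conj I I)).
have cont1 := lipschitz_continuous M0 lip.
have FF := within_infinite_proper hK.
set F := within K \oo in FF hcrit hweak *.
pose x := iter_x r; pose h := crit phi0 phi1 r; pose t := step_t r.
pose g := model_g r; pose b := model_b r; pose A := model_A r.
pose p k := prox (fun z => (t k)%:E * model_psi phi0 phi1 r k z)%E (x k - t k *: g k).
pose D := 'd f1 xbar; pose G := grad f0hat xbar; pose y0 := f1 xbar.
have cD k : continuous ('d f1 (x k)) by exact: diff_continuous.
have cDbar : continuous D by exact: diff_continuous.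
have t0 k : 0 < t k by exact: alg_t halg k.
have px k : `|p k - x k| = t k * h k by rewrite /h /crit mulrA mulfV ?gt_eqF// mul1r.
have h0 k : 0 <= h k by rewrite -(pmulr_rge0 _ (t0 k)) -px.
have tmax0 : 0 <= tmax := le_trans (ltW htmin) htminmax.
have pxh k : 0 <= `|p k - x k| <= tmax * h k.
  by rewrite normr_ge0 px ler_wpM2r//; have /andP[] := ht k.
have [[_ _ kg0] [kv0 kj0 _]] := (ok_kappa_pos (alg_constants halg), ok_kappa_pos' (alg_constants halg)).
have minh (kap d : R) k : 0 < kap -> kap * Num.min (h k) d <= kap * h k.
  by move=> kap0; rewrite ler_pM2l// ge_min lexx.
have gh k : `|g k - grad f0 (x k)| <= kappa_grad c * h k.
  exact: le_trans (alg_grad halg k) (minh _ _ _ kg0).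
have bh k : `|b k - f1 (x k)| <= kappa_val c * h k.
  exact: le_trans (alg_val halg k) (minh _ _ _ kv0).
have Ah k : opnorm (A k \- 'd f1 (x k)) <= kappa_jac c * h k.
  exact: le_trans (alg_jac halg k) (minh _ _ _ kj0).
have hF : h @ F --> 0 by exact: hcrit.
have f1F : f1 (x k) @[k --> F] --> y0 by exact: completely_continuous_within.
have GF : grad f0hat (x k) @[k --> F] --> G by exact: completely_continuous_within.
have DF : D (x k) @[k --> F] --> D xbar.
  by apply: completely_continuous_within => //; exact: diff_completely_continuous.
have dF : opnorm ('d f1 (x k) \- D) @[k --> F] --> 0.
  have := hccdf1 _ _ (weak_cvg_extend hweak); apply: within_cvg => k Kk.
  by rewrite mem_set.
(* Errors of the linear part, of the constant part and of the slope, relative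
   to the linearization at xbar. *)
pose eA k := kappa_jac c * h k + opnorm ('d f1 (x k) \- D).
pose eb k := kappa_val c * h k + (`|f1 (x k) - y0| + `|D (x k) - D xbar|).
pose eR k := h k + kappa_grad c * h k + tau * (tmax * h k) + `|grad f0hat (x k) - G|.
have opn0 k : 0 <= opnorm ('d f1 (x k) \- D).
  apply: (@opnorm_ge0 _ _ _ ('d f1 (x k) \- D : {linear X -> Y})).
  by move=> z; apply: cvgB; [exact: cD|exact: cDbar].
have eA0 k : 0 <= eA k by apply: addr_ge0 => //; apply: mulr_ge0 => //; exact: ltW.
have eb0 k : 0 <= eb k.
  by rewrite !addr_ge0// mulr_ge0// ltW.
have eR0 k : 0 <= eR k.
  by rewrite !addr_ge0//; do ?[apply: mulr_ge0 => //]; exact: ltW.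
have eAF : eA @ F --> 0 by apply: cvg0D => //; exact: cvg0M.
have ebF : eb @ F --> 0.
  by apply: cvg0D; [exact: cvg0M|apply: cvg0D; exact: cvg0_dist].
have eRF : eR @ F --> 0.
  apply: cvg0D; last exact: cvg0_dist.
  by apply: cvg0D; [apply: cvg0D => //|apply: (cvg0M (u := fun k => tmax * h k))]; exact: cvg0M.
have pxF : (p k - x k) @[k --> F] --> 0.
  by apply/norm_cvg0P; apply: cvg0_squeeze pxh hF.
have [C0 C00 HC0] := weak_cvg_bounded (weak_cvg_extend hweak).
pose C := C0 + `|xbar| + tmax.
have C_0 : 0 <= C by rewrite !addr_ge0// ltW.
(* Indices in K with h_k <= 1, on which the proximal points are bounded too. *)
pose K1 := [set k | K k /\ h k <= 1].
have FK1 : F K1.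
  apply: filterI; first exact: withinT.
  exact: cvgr_le hF _ ltr01.
have xC k : K1 k -> `|x k - xbar| <= C.
  move=> [Kk _]; apply: le_trans (ler_normB _ _) _.
  by have := HC0 k; rewrite mem_set// -/(x k) /C; lra.
have pC k : K1 k -> `|p k - xbar| <= C.
  move=> [Kk hk]; have /andP[_ H] := pxh k.
  have -> : p k - xbar = (p k - x k) + (x k - xbar) by rewrite addrA subrK.
  apply: le_trans (ler_normD _ _) _.
  have H1 : tmax * h k <= tmax by exact: (ler_piMr tmax0 hk).
  have H2 := ler_normB (x k) xbar.
  by have := HC0 k; rewrite mem_set// -/(x k) /C; lra.
pose psi z := ((phi1 (y0 + D (z - xbar)))%:E + phi0 z)%E.
have [psipr psicl _] : [/\ proper_efun psi, closed_efun psi & convex_efun psi].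
  suff <- : (fun z => 1%:E * psi z)%E = psi.
    exact: (scaled_sum_efun pr cl cv (continuous_affine (x0 := xbar) (c := y0) cDbar cont1)
      (convex_real_affine D xbar y0 cv1) ltr01).
  by apply/funext => z; rewrite mul1e.
pose delta k := (M * (eA k + eb k) * (2 + C) + eR k) * (1 + C).
have pw : weak_cvg F p xbar.
  move=> y.
  have -> : (fun k => dot (p k) y) = (fun k => dot (x k) y + dot (p k - x k) y).
    by apply/funext => k; rewrite -dotDl addrC subrK.
  rewrite -[X in _ --> X]addr0; apply: cvgD; first exact: hweak.
  by rewrite -(dot0l y); apply: cvg_dot => //; exact: cvg_cst.
have HA k d : `|A k d - D d| <= eA k * `|d|.
  have -> : A k d - D d = (A k d - 'd f1 (x k) d) + ('d f1 (x k) d - D d).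
    by rewrite addrA subrK.
  apply: le_trans (ler_normD _ _) _; rewrite mulrDl; apply: lerD.
    apply: le_trans (opnormB_bound _ _ _) _ => //; first exact: (alg_bounded halg k).1.
    exact: ler_wpM2r.
  exact: opnormB_bound.
have Hb k : `|b k - y0 - D (x k - xbar)| <= eb k.
  have -> : b k - y0 - D (x k - xbar) =
      (b k - f1 (x k)) + ((f1 (x k) - y0) - (D (x k) - D xbar)).
    by rewrite linearB addrA addrA subrK.
  apply: le_trans (ler_normD _ _) _; apply: lerD => //.
  exact: ler_normB.
have HR k : `|(t k)^-1 *: (x k - t k *: g k - p k) + tau *: p k + G| <= eR k.
  have -> : (t k)^-1 *: (x k - t k *: g k - p k) + tau *: p k + G =
      - ((t k)^-1 *: (p k - x k)) - (g k - grad f0 (x k)) + tau *: (p k - x k)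
      - (grad f0hat (x k) - G).
    rewrite (grad_sqnormD hf0)//; apply: dot_inj => d; rewrite !dotE.
    by field; rewrite gt_eqF.
  do 3?[apply: le_trans (ler_normD _ _) _; apply: lerD]; rewrite ?normrN//.
  - by rewrite normrZ px gtr0_norm ?invr_gt0// mulKf ?gt_eqF.
  - rewrite normrZ gtr0_norm//; apply: ler_wpM2l; first exact: ltW.
    by have /andP[] := pxh k.
have VI k : K1 k -> exists2 a, psi (p k) = a%:E &
    forall z s, (psi z <= s%:E)%E ->
      a - tau * dot (p k) (z - p k) - dot G (z - p k) - delta k * (1 + `|z - xbar|) <= s.
  move=> Kk.
  have ellE : (fun z => phi1 (model_ell r k z)) = (fun z => phi1 (b k + A k (z - x k))).
    by apply/funext => z; rewrite addrC.
  have [||a pa step] := @prox_scaled_sum _ _ phi0 (fun z => phi1 (model_ell r k z)) (t k)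
     pr cl cv _ _ (t0 k) (x k - t k *: g k).
  - by rewrite ellE; apply: continuous_affine => //; exact: (alg_bounded halg k).1.
  - by rewrite ellE; exact: convex_real_affine.
  exists (phi1 (y0 + D (p k - xbar)) + a); first by rewrite /psi pa.
  move=> z s zs.
  have zs' : (phi0 z <= (s - phi1 (y0 + D (z - xbar)))%:E)%E.
    move: zs; rewrite /psi; case: (phi0 z) => [e| |].
    - by rewrite -EFinD !lee_fin; lra.
    - by rewrite addey.
    - by move=> _; exact: leNye.
  have := @perturbed_subgradient R X Y phi0 phi1 (A k) D (b k) y0 (x k) (p k) (g k) G xbar
    M C (eA k) (eb k) (eR k) tau (t k) a (linearD _) (linearD _) (t0 k) M0 lip C_0
    (xC k Kk) (pC k Kk) (eA0 k) (HA k) (Hb k) (HR k) step z _ zs'.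
  by rewrite -/(delta k); lra.
have [||pF xdom sub] := approx_subgradient_cvg (F := F) (delta := delta) (A := K1)
   (tau := tau) (C := C) (G := G) psipr psicl htau FK1 _ _ pC pw VI.
- move=> k _; apply: mulr_ge0; last exact: addr_ge0.
  apply: addr_ge0 => //; apply: mulr_ge0; last exact: addr_ge0.
  by apply: mulr_ge0; [exact: ltW|exact: addr_ge0].
- have -> : delta = (fun k => (1 + C) * (M * (2 + C) * (eA k + eb k) + eR k)).
    by apply/funext => k; rewrite /delta; ring.
  by apply: cvg0M; apply: cvg0D => //; apply: cvg0M; exact: cvg0D.
split; last first.
  move=> _ _ _; have -> : iter_x r = (fun k => p k - (p k - x k)).
    by apply/funext => k; rewrite subKr.
  by rewrite -[X in _ --> X]subr0; exact: cvgB.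
have xfin : exists a, phi0 xbar = a%:E.
  apply: proper_fin => //; move: xdom; rewrite /dom/= /psi.
  by case: (phi0 xbar) => [e _|//|//]; exact: ltry.
have [th [Hth Hphi]] := subdiff_comp_sum cv xfin cv1 M0 lip sub.
exists th; split.
  by move=> y /=; rewrite -EFinD lee_fin.
move=> z; apply: le_trans (Hphi z); apply: leeD2l; rewrite lee_fin.
rewrite (grad_sqnormD hf0)// opprD dotDl (dotNl (adjoint _ _)) (dotC (adjoint _ _)).
by rewrite -(adjointE _ _ cDbar) (dotC _ th).
Qed.
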